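(* Let $\mathbb{X}$ be a reflexive, smooth and strictly convex complex Banach space and let $\mathbb{Y}$ be a closed proper subspace of $\mathbb{X}$. Then the following are equivalent. (i) $\mathbb{Y}$ is left-complemented in $\mathbb{X}$. (ii) There is a non-trivial subspace $\widetilde{\mathbb{Y}}$ in $\mathbb{X}$ such that $S_{\widetilde{\mathbb{Y}}}=\bigcup_{f\in\mathrm{Ann}(\mathbb{Y})\setminus\{\mathbf 0\}}M_f$. (iii) There is a closed subspace $\widetilde{\mathbb{Y}}_1$ of $\mathbb{X}$ such that the restriction map $f\mapsto f|_{\widetilde{\mathbb{Y}}_1}$ from $\mathrm{Ann}(\mathbb{Y})$ to $\widetilde{\mathbb{Y}}_1^*$ is a surjective isometry. (iv) There is a subspace $\widehat{\mathbb{Y}}_1$ in $\mathbb{X}$ such that every $f\in\mathrm{Ann}(\mathbb{Y})$ attains its norm in $\widehat{\mathbb{Y}}_1$, the linear map $\Theta:\mathbb{X}^*\to\widehat{\mathbb{Y}}_1^*$ defined by $\Theta(f)=f|_{\widehat{\mathbb{Y}}_1}$ has norm one, and the norm attainment set $M_\Theta$ of $\Theta$ is given by $M_\Theta=\{f\in S_{\mathbb{X}^*}:\ f\in\mathrm{Ann}(\mathbb{Y})\}$.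
   Context: For a normed space $\mathbb{Z}$, $S_{\mathbb{Z}}$ is its set of unit vectors; subspaces are linear. For $f\in\mathbb{X}^*$, $M_f=\{y\in S_{\mathbb{X}}:|f(y)|=\|f\|\}$, and for the operator $\Theta$, $M_\Theta=\{f\in S_{\mathbb{X}^*}:\|\Theta(f)\|=\|\Theta\|\}$. ''$f$ attains its norm in $\widehat{\mathbb{Y}}_1$'' means there is a unit vector $z\in\widehat{\mathbb{Y}}_1$ with $|f(z)|=\|f\|$. $\mathrm{Ann}(\mathbb{Y})=\{f\in\mathbb{X}^*: f|_{\mathbb{Y}}=\mathbf 0\}$. $x\perp_B y$ (Birkhoff-James) means $\|x+\lambda y\|\ge\|x\|$ for all $\lambda\in\mathbb{C}$; for subspaces the relation is required for all pairs of elements. A closed subspace $\mathbb{Y}$ is left-complemented in $\mathbb{X}$ if there is a closed subspace $\widetilde{\mathbb{Y}}$ that is a vector space complement of $\mathbb{Y}$ with $\widetilde{\mathbb{Y}}\perp_B\mathbb{Y}$. $\mathbb{X}$ is smooth if each nonzero $x\in\mathbb{X}$ has a unique support functional, i.e. a unique $f\in\mathbb{X}^*$ with $\|f\|=\|x\|$, $f(x)=\|x\|^2$. *)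

(* Defs.v *)
From HB Require Import structures.
From mathcomp Require Import all_boot all_order all_algebra.
From mathcomp Require Import complex.
From mathcomp Require Import boolp classical_sets functions reals topology.
From mathcomp Require Import normedtype.

Set Implicit Arguments.
Unset Strict Implicit.
Unset Printing Implicit Defensive.

Import Order.TTheory GRing.Theory Num.Theory.
Import numFieldNormedType.Exports.

Local Open Scope classical_set_scope.
Local Open Scope ring_scope.
Local Open Scope complex_scope.

(* Norms on an [R[i]]-normed module take their values in [R[i]] (they are
   nonnegative reals there), so the real supremum is re-embedded. The value is
   meaningful when [f] is linear and bounded. *)
Definition opnorm (R : realType) (V W : normedModType R[i]) (f : V -> W) :
  R[i] := (sup [set complex.Re `|f x| | x in [set x : V | `|x| <= 1]])%:C.

Section OpnormTheory.
Context {R : realType} {V W : normedModType R[i]}.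
Implicit Type f : {linear V -> W}.

Lemma Re_norm (U : normedModType R[i]) (u : U) : (complex.Re `|u|)%:C = `|u|.
Proof. by rewrite RRe_real// ger0_real. Qed.

Let opset f := [set complex.Re `|f x| | x in [set x : V | `|x| <= 1]].

Lemma opnorm_ge0 (f : V -> W) : 0 <= opnorm f.
Proof.
rewrite /opnorm ler0c; set A := [set _ | _ in _].
have A0 r : A r -> 0 <= r by case=> x _ <-; rewrite -ler0c Re_norm.
case: (pselect (has_sup A)) => [hA|/sup_out -> //].
have [[r Ar] _] := hA.
by rewrite (le_trans (A0 _ Ar))//; apply: sup_upper_bound.
Qed.

Lemma opnorm_le f (M : R[i]) : (forall x, `|f x| <= M * `|x|) -> 0 <= M ->
  opnorm f <= M.
Proof.
move=> fM M0; rewrite /opnorm -(RRe_real (ger0_real M0)) lecR.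
apply: ge_sup.
  by exists 0; exists 0; rewrite /= ?normr0 ?ler01// linear0 normr0.
move=> _ [x /= x1 <-]; rewrite -lecR Re_norm (RRe_real (ger0_real M0)).
by rewrite (le_trans (fM x))// ler_piMr.
Qed.

Lemma le_opnorm f : continuous f -> forall x, `|f x| <= opnorm f * `|x|.
Proof.
move=> /linear_bounded_continuous/linear_boundedP/pinfty_ex_gt0[M M0 fM].
have ub x : `|x| <= 1 -> `|f x| <= opnorm f.
  move=> x1; rewrite -[`|f x|]Re_norm /opnorm lecR.
  apply: sup_upper_bound; last by exists x.
  split; first by exists (complex.Re `|f x|); exists x.
  exists (complex.Re M) => _ [y /= y1 <-].
  rewrite -lecR Re_norm RRe_real ?gtr0_real//.
  by rewrite (le_trans (fM y))// ler_piMr// ltW.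
move=> x; have [->|x0] := eqVneq x 0; first by rewrite linear0 !normr0 mulr0.
have nx : 0 < `|x| by rewrite normr_gt0.
rewrite -ler_pdivrMr//.
have -> : `|f x| / `|x| = `|f (`|x|^-1 *: x)|.
  by rewrite linearZ/= normrZ normfV normr_id mulrC.
by apply: ub; rewrite normrZ normfV normr_id mulVf// gt_eqF.
Qed.

End OpnormTheory.

Section Dual.
Context {R : realType} {V : normedModType R[i]}.

Definition dual_pred : {pred V -> R[i]^o} :=
  fun f => `[< linear f /\ continuous f >].

Lemma dual_pred_submod : submod_closed dual_pred.
Proof.
split=> [|a f g /asboolP[lf cf] /asboolP[lg cg]]; apply/asboolP; split.
- by move=> a x y /=; rewrite /GRing.zero/= scaler0 addr0.
- exact: cst_continuous.
- move=> b x y; rewrite !fctE lf lg !scalerDr !scalerA [b * a]mulrC.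
  by rewrite -!addrA; congr (_ + _); rewrite addrCA.
- move=> x; apply: (@continuousD _ _ _ (a *: f) g); last exact: cg.
  by apply: (@continuousZr _ _ _ f); exact: cf.
Qed.

HB.instance Definition _ := GRing.isSubmodClosed.Build R[i] (V -> R[i]^o)
  dual_pred dual_pred_submod.

End Dual.
Arguments dual_pred {R} V.

Record dual (R : realType) (V : normedModType R[i]) := Dual {
  dual_fun :> V -> R[i]^o;
  dualP : dual_fun \in dual_pred V }.

Section DualNorm.
Context {R : realType} {V : normedModType R[i]}.
Local Notation dual := (dual V).

HB.instance Definition _ := [isSub for @dual_fun R V].
HB.instance Definition _ := [Choice of dual by <:].
HB.instance Definition _ := [SubChoice_isSubLmodule of dual by <:].

Lemma dual_linear (f : dual) : linear f.
Proof. by have /asboolP[] := dualP f. Qed.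

Lemma dual_continuous (f : dual) : continuous f.
Proof. by have /asboolP[] := dualP f. Qed.

HB.instance Definition _ (f : dual) :=
  GRing.isLinear.Build R[i] V R[i]^o *:%R (dual_fun f) (@dual_linear f).


Definition dual_norm (f : dual) : R[i] := opnorm f.

Lemma dual_normD (f g : dual) :
  dual_norm (f + g) <= dual_norm f + dual_norm g.
Proof.
apply: opnorm_le => [x|]; last by rewrite addr_ge0// opnorm_ge0.
rewrite mulrDl /= [X in `|X|](_ : _ = f x + g x)// (le_trans (ler_normD _ _))//.
by rewrite lerD//; apply: le_opnorm; exact: dual_continuous.
Qed.

Lemma dual_normZ_le a (f : dual) : dual_norm (a *: f) <= `|a| * dual_norm f.
Proof.
apply: opnorm_le => [x|]; last by rewrite mulr_ge0// opnorm_ge0.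
rewrite /= [X in `|X|](_ : _ = a *: f x)// normrZ -mulrA ler_wpM2l//.
by apply: le_opnorm; exact: dual_continuous.
Qed.

Lemma dual_normZ a (f : dual) : dual_norm (a *: f) = `|a| * dual_norm f.
Proof.
have [->|a0] := eqVneq a 0.
  apply/eqP; rewrite eq_le dual_normZ_le/= normr0 mul0r; exact: opnorm_ge0.
apply/eqP; rewrite eq_le dual_normZ_le/=.
have := dual_normZ_le a^-1 (a *: f).
by rewrite scalerA mulVf// scale1r normfV ler_pdivlMl// normr_gt0.
Qed.

Lemma dual_norm0_eq0 (f : dual) : dual_norm f = 0 -> f = 0.
Proof.
move=> f0; apply/val_inj/funext => x; apply/normr0_eq0/le_anti.
rewrite normr_ge0 andbT.
by have := le_opnorm (@dual_continuous f) x; rewrite -/(dual_norm f) f0 mul0r.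
Qed.

HB.instance Definition _ := Lmodule_isNormed.Build R[i] dual
  dual_normD dual_normZ dual_norm0_eq0.

End DualNorm.

(* Linear subspaces are the elements of the library's [submodClosed X]. *)
Section Subsp.
Context {R : realType} {X : normedModType R[i]}.

Definition subsp (S : submodClosed X) := {x : X | x \in S}.

Section Instances.
Variable S : submodClosed X.

HB.instance Definition _ := SubType.on (subsp S).
HB.instance Definition _ := [Choice of subsp S by <:].
HB.instance Definition _ := [SubChoice_isSubLmodule of subsp S by <:].

Definition subsp_norm (x : subsp S) : R[i] := `|val x|.

Lemma subsp_normD x y : subsp_norm (x + y) <= subsp_norm x + subsp_norm y.
Proof. exact: ler_normD. Qed.

Lemma subsp_normZ a x : subsp_norm (a *: x) = `|a| * subsp_norm x.
Proof. exact: normrZ. Qed.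

Lemma subsp_norm0_eq0 x : subsp_norm x = 0 -> x = 0.
Proof. by move=> /normr0_eq0 x0; apply: val_inj. Qed.

HB.instance Definition _ := Lmodule_isNormed.Build R[i] (subsp S)
  subsp_normD subsp_normZ subsp_norm0_eq0.

End Instances.

Lemma restr_subproof (S : submodClosed X) (f : dual X) :
  (fun x : subsp S => f (val x)) \in dual_pred (subsp S).
Proof.
have lf : linear (fun x : subsp S => f (val x)).
  by move=> a x y; rewrite -linearP.
apply/asboolP; split=> //.
pose h := HB.pack_for {linear subsp S -> R[i]^o}
  (fun x : subsp S => f (val x)) (GRing.isLinear.Build _ _ _ _ _ lf).
apply: (@bounded_linear_continuous _ _ _ h); apply/linear_boundedP.
have := @dual_continuous _ _ f.
move=> /linear_bounded_continuous/linear_boundedP.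
by apply: filterS => r fr x; exact: (fr (val x)).
Qed.

Definition restr (S : submodClosed X) (f : dual X) : dual (subsp S) :=
  Dual (restr_subproof S f).

Lemma restr_linear (S : submodClosed X) : linear (restr S).
Proof. by move=> a f g; apply: val_inj. Qed.

HB.instance Definition _ (S : submodClosed X) :=
  GRing.isLinear.Build R[i] (dual X) (dual (subsp S)) *:%R (restr S)
    (@restr_linear S).

End Subsp.

Section Geometry.
Context {R : realType} {X : normedModType R[i]}.
Implicit Types (Y Z : submodClosed X) (x y : X) (f : dual X).

Definition sphere {U : normedModType R[i]} (A : set U) : set U :=
  [set x | A x /\ `|x| = 1].

Definition norm_attainment {V W : normedModType R[i]} (f : V -> W) : set V :=
  [set x | `|x| = 1 /\ `|f x| = opnorm f].

Definition attains_norm_in f Y := exists z, sphere [set` Y] z /\ `|f z| = `|f|.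

Definition Ann Y : set (dual X) := [set f | forall y, y \in Y -> f y = 0].

Definition birkhoff_james x y := forall l : R[i], `|x| <= `|x + l *: y|.

Definition left_complemented Y := exists Z : submodClosed X,
  [/\ closed [set` Z],
      [set` Y] `&` [set` Z] = [set 0],
      (forall x, exists2 y, y \in Y & exists2 z, z \in Z & x = y + z) &
      (forall z y, z \in Z -> y \in Y -> birkhoff_james z y)].

Definition smooth := forall x, x != 0 ->
  exists! f, `|f| = `|x| /\ f x = `|x| ^+ 2.

Definition strictly_convex := forall x y (t : R), `|x| = 1 -> `|y| = 1 ->
  x <> y -> 0 < t -> t < 1 -> `|t%:C *: x + (1 - t)%:C *: y| < 1.

(* The canonical embedding of [X] into its bidual is onto. *)
Definition reflexive_space := forall phi : dual (dual X),
  exists x, forall f, phi f = f x.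

End Geometry.
Arguments smooth {R} X.
Arguments strictly_convex {R} X.
Arguments reflexive_space {R} X.

(* Main.v *)
From HB Require Import structures.
Require Import Defs.
From mathcomp Require Import all_boot all_order all_algebra.
From mathcomp Require Import complex.
From mathcomp Require Import boolp classical_sets functions reals topology.
From mathcomp Require Import normedtype.
From mathcomp Require Import ring lra.

(** Let [orth Y] be the set of [x] with [x ⊥_B y] for all [y] in [Y]. By
    Hahn-Banach, the unit vectors of [orth Y] are exactly the norm attaining
    points of the nonzero functionals in [Ann Y], and reflexivity yields
    [X = Y + orth Y]. Each condition then says that [orth Y] is a linear
    subspace: the subspace occurring in (i), (ii) and (iv) is [orth Y]. In
    (i) and (iv) strict convexity identifies it, a functional attaining its norm
    at only one point up to a phase. Conversely, if [orth Y] is a subspace then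
    the projection onto it along [Y] is contractive, which gives (iii), and
    smoothness recovers a functional from its restriction to a subspace on
    which it attains its norm, which gives (iv). *)

Set Implicit Arguments.
Unset Strict Implicit.
Unset Printing Implicit Defensive.

Import Order.TTheory GRing.Theory Num.Theory.
Import numFieldNormedType.Exports.

Local Open Scope classical_set_scope.
Local Open Scope ring_scope.
Local Open Scope complex_scope.

(** * Real Hahn-Banach theorem for a sublinear bound [p] *)

Section RealHahnBanach.
Context {R : realType} {V : lmodType R[i]}.
Context (p : V -> R)
  (p_subadd : forall x y, p (x + y) <= p x + p y)
  (p_homog : forall (t : R) x, 0 < t -> p (t%:C *: x) = t * p x).

(** Partial functionals are encoded by their graphs, so that extension is inclusion. Scalars of [V]
    are complex, hence the embedding [t%:C]. Single-valuedness is left out, since domination by [p]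
    implies it. *)
Definition real_linear_graph (G : set (V * R)) :=
  G (0, 0) /\ forall (t : R) u v, G u -> G v ->
    G (t%:C *: u.1 + v.1, t * u.2 + v.2).

Definition dominated_graph (G : set (V * R)) :=
  real_linear_graph G /\ forall u, G u -> u.2 <= p u.1.

(** Subtracting the two pairs puts (0, b - a) and (0, a - b) in [G], and p 0 = 0 by homogeneity. *)
Lemma dominated_graph_functional G x a b :
  dominated_graph G -> G (x, a) -> G (x, b) -> a = b.
Proof.
move=> [[_ Glin] Gp].
have p0 : p 0 = 0.
  have := @p_homog 2 0 ltac:(by []); rewrite scaler0; lra.
suff le_ c d : G (x, c) -> G (x, d) -> d <= c.
  by move=> Ga Gb; apply/eqP; rewrite eq_le !le_.
move=> Gc Gd; have := Gp _ (Glin (-1) _ _ Gc Gd).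
by rewrite /= rmorphN1 scaleN1r addNr p0; lra.
Qed.

(** Chain condition for Zorn's lemma. The union with [G0] covers the empty chain and makes every
    member extend [G0]. *)
Lemma dominated_graph_bigcup G0 (F : set (set (V * R))) :
  dominated_graph G0 -> (forall G, F G -> dominated_graph (G0 `|` G)) ->
  total_on F subset -> dominated_graph (G0 `|` \bigcup_(G in F) G).
Proof.
move=> G0d Fd Ftot.
have sub G : F G -> G0 `|` G `<=` G0 `|` \bigcup_(G in F) G.
  by move=> FG u [|Gu]; [left|right; exists G].
have in1 u : (G0 `|` \bigcup_(G in F) G) u -> G0 u \/ exists2 G, F G & G u.
  by case=> [|[G FG Gu]]; [left|right; exists G].
split; last first.
  by move=> u /in1[/(G0d.2 u)//|[G FG Gu]]; apply: (Fd _ FG).2; right.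
split; first by left; exact: G0d.1.1.
move=> t u v /in1[G0u|[G FG Gu]] /in1[G0v|[H FH Hv]].
- by left; apply: G0d.1.2.
- by apply: (sub _ FH); apply: (Fd _ FH).1.2; [left|right].
- by apply: (sub _ FG); apply: (Fd _ FG).1.2; [right|left].
- case: (Ftot _ _ FG FH) => GH.
    by apply: (sub _ FH); apply: (Fd _ FH).1.2; right => //; exact: GH.
  by apply: (sub _ FG); apply: (Fd _ FG).1.2; right => //; exact: GH.
Qed.

Definition graph_adjoin (G : set (V * R)) (x0 : V) (c : R) : set (V * R) :=
  [set u | exists t v, G v /\ u = (v.1 + t%:C *: x0, v.2 + t * c)].

(** The value [c] at [x0] has to lie between all v.2 - p (v.1 - x0) and all p (v.1 + x0) - v.2.
    Subadditivity puts each of the former below each of the latter, so the supremum of the former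
    serves. *)
Lemma dominated_graph_adjoin G x0 : dominated_graph G ->
  exists c, dominated_graph (graph_adjoin G x0 c).
Proof.
move=> Gd; have [[G0 Glin] Gp] := Gd.
have Gscale t v : G v -> G (t%:C *: v.1, t * v.2).
  by move=> Gv; have := Glin t _ _ Gv G0; rewrite /= !addr0.
pose A := [set v.2 - p (v.1 - x0) | v in G].
have Aub v : G v -> ubound A (p (v.1 + x0) - v.2).
  move=> Gv _ [u Gu <-].
  have := Gp _ (Glin 1 _ _ Gu Gv); rewrite /= rmorph1 scale1r mul1r.
  have := p_subadd (u.1 - x0) (v.1 + x0).
  by rewrite addrACA addNr addr0; lra.
have Asup : has_sup A.
  split; first by exists (0 - p (0 - x0)); exists (0, 0).
  by exists (p (0 + x0) - 0); exact: Aub _ G0.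
have c1 v : G v -> v.2 + sup A <= p (v.1 + x0).
  by move=> Gv; have := ge_sup Asup.1 (Aub _ Gv); lra.
have c2 v : G v -> v.2 - sup A <= p (v.1 - x0).
  move=> Gv; have : v.2 - p (v.1 - x0) <= sup A.
    by apply: sup_upper_bound => //; exists v.
  by lra.
exists (sup A); split; first split.
- by exists 0, (0, 0); split => //=; rewrite rmorph0 scale0r mul0r !addr0.
- move=> t _ _ [r [u [Gu ->]]] [s [v [Gv ->]]].
  exists (t * r + s), (t%:C *: u.1 + v.1, t * u.2 + v.2); split; first exact: Glin.
  congr pair => /=; last by ring.
  by rewrite rmorphD rmorphM scalerDr scalerDl scalerA addrACA.
- move=> _ [t [v [Gv ->]]] /=.
  (* Homogeneity reduces t < 0 to [c2] and t > 0 to [c1]. *)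
  have [t0|t0|->] := ltgtP t 0; last 1 first.
  + by rewrite rmorph0 scale0r mul0r !addr0; exact: Gp.
  + have nt0 : 0 < - t by rewrite oppr_gt0.
    have /c2/= := Gscale (- t)^-1 _ Gv.
    rewrite -(ler_pM2l nt0) -p_homog// scalerBr scalerA -rmorphM mulfV ?gt_eqF//.
    rewrite rmorph1 scale1r rmorphN scaleNr opprK; apply: le_trans.
    by rewrite mulrBr mulrA mulfV ?gt_eqF// mul1r mulNr opprK.
  + have /c1/= := Gscale t^-1 _ Gv.
    rewrite -(ler_pM2l t0) -p_homog// scalerDr scalerA -rmorphM mulfV ?gt_eqF//.
    rewrite rmorph1 scale1r; apply: le_trans.
    by rewrite mulrDr mulrA mulfV ?gt_eqF// mul1r.
Qed.

Lemma real_hahn_banach G0 : dominated_graph G0 ->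
  exists f : V -> R, [/\ forall (t : R) x y, f (t%:C *: x + y) = t * f x + f y,
    forall x, f x <= p x & forall u, G0 u -> f u.1 = u.2].
Proof.
move=> G0d; have [|G [Gd Gmax]] := @Zorn_bigcup _ [set G | dominated_graph (G0 `|` G)].
  by move=> F FP Ftot; exact: dominated_graph_bigcup.
set A := G0 `|` G in Gd.
have Atot x : exists a, A (x, a).
  have [c cd] := dominated_graph_adjoin x Gd.
  set B := graph_adjoin A x c in cd.
  have AB : A `<=` B.
    move=> [y b] Au; exists 0, (y, b); split => //=.
    by rewrite rmorph0 scale0r mul0r !addr0.
  have G0B : G0 `|` B = B by apply/setUidPr => u G0u; apply: AB; left.
  have GB : G `<=` B by move=> u Gu; apply: AB; right.
  (* [B] is dominated and contains [G0] and [G], so maximality of [G] leaves no room for a proper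
     extension. *)
  have BG : B `<=` G.
    by apply: contrapT => nBG; apply: (Gmax B); rewrite /= ?G0B.
  exists c; right; apply: BG; exists 1, (0, 0); split; first exact: Gd.1.1.
  by rewrite /= rmorph1 scale1r mul1r !add0r.
have [f fA] := choice Atot.
exists f; split.
- move=> t x y; apply: (dominated_graph_functional Gd (fA _)).
  exact: Gd.1.2 _ _ _ (fA x) (fA y).
- by move=> x; exact: Gd.2 _ (fA x).
- by move=> [x a] G0u; apply: (dominated_graph_functional Gd (fA _)); left.
Qed.

End RealHahnBanach.

(** * Complex Hahn-Banach theorem *)

Section ComplexHahnBanach.
Context {R : realType} {V : normedModType R[i]}.
Implicit Types (f : dual V) (M : R[i]).

Lemma dual_le f x : `|f x| <= `|f| * `|x|.
Proof. exact: (le_opnorm (@dual_continuous _ _ f)). Qed.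

Lemma dual_norm_le f M : 0 <= M -> (forall x, `|f x| <= M * `|x|) -> `|f| <= M.
Proof. by move=> M0 fM; exact: (opnorm_le fM M0). Qed.

Lemma dual_of_bounded (h : V -> R[i]^o) M : linear h -> 0 <= M ->
  (forall x, `|h x| <= M * `|x|) -> exists2 f : dual V, forall x, f x = h x & `|f| <= M.
Proof.
move=> lh M0 hM.
have hP : h \in dual_pred V.
  apply/asboolP; split => //.
  pose k := HB.pack_for {linear V -> R[i]^o} h (GRing.isLinear.Build _ _ _ _ _ lh).
  apply: (@bounded_linear_continuous _ _ _ k); apply/linear_boundedP.
  near=> r; move=> x; apply: le_trans (hM x) _.
  by rewrite ler_wpM2r//; near: r; apply: nbhs_pinfty_ge; rewrite ger0_real.
by exists (Dual hP) => //; exact: dual_norm_le.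
Unshelve. all: by end_near. Qed.

(** The real theorem extends the real part of [G], and the complex functional is rebuilt from its
    real part. Working with a graph spares a check of well-definedness, which the bound by [M]
    implies. *)
Lemma hahn_banach_graph (G : set (V * R[i])) M : 0 <= M -> G (0, 0) ->
  (forall l u v, G u -> G v -> G (l *: u.1 + v.1, l * u.2 + v.2)) ->
  (forall u, G u -> `|u.2| <= M * `|u.1|) ->
  exists2 f : dual V, `|f| <= M & forall u, G u -> f u.1 = u.2.
Proof.
move=> M0 G0 Glin GM.
pose p (x : V) := complex.Re (M * `|x|).
have pE x : (p x)%:C = M * `|x| by rewrite RRe_real// ger0_real// mulr_ge0.
have pD x y : p (x + y) <= p x + p y.
  by rewrite -lecR rmorphD/= !pE -mulrDr ler_wpM2l// ler_normD.
have pZ (t : R) x : 0 < t -> p (t%:C *: x) = t * p x.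
  move=> t0; apply: complexI; rewrite rmorphM/= !pE normrZ mulrCA.
  by rewrite [`|t%:C|]ger0_norm// ler0c ltW.
pose G' := [set (u.1, complex.Re u.2) | u in G].
have G'd : dominated_graph p G'.
  split; first split.
  - by exists (0, 0).
  - move=> t _ _ [u Gu <-] [v Gv <-]; eexists; first exact: (Glin t%:C _ _ Gu Gv).
    by case: u.2 v.2 => [a b] [c d] /=; rewrite mul0r subr0.
  - move=> _ [u Gu <-] /=; rewrite -lecR pE; apply: le_trans (GM _ Gu).
    by apply: le_trans (normc_ge_Re _); rewrite lecR ler_norm.
have [F [Flin Fp FG]] := real_hahn_banach pD pZ G'd.
(* A complex-linear functional with real part [F] must have imaginary part - F (i x). *)
pose f x := (F x -i* F ('i%C *: x)) : R[i]^o.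
have F0 : F 0 = 0 by have := FG (0, 0); apply; exists (0, 0).
have flin : linear f.
  move=> [a b] x y.
  have abE (z : V) : (a +i* b) *: z = a%:C *: z + b%:C *: ('i%C *: z).
    rewrite scalerA -scalerDl; congr (_ *: _); apply/eqP.
    rewrite eq_complex /= !mul0r mulr0 mulr1 subrr addr0 add0r addr0 eqxx /=.
    by apply/eqP; ring.
  have iE : 'i%C *: ((a +i* b) *: x + y) =
      a%:C *: ('i%C *: x) + ((- b)%:C *: x + 'i%C *: y).
    rewrite scalerDr abE addrA; congr (_ + _); rewrite scalerDr !scalerA -!scalerDl.
    congr (_ *: _); apply/eqP; rewrite eq_complex /=; apply/andP; split; apply/eqP; ring.
  rewrite /f iE !Flin abE -addrA !Flin.
  by apply/eqP; rewrite eq_complex /=; apply/andP; split; apply/eqP; ring.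
have fM x : `|f x| <= M * `|x|.
  have [->|fx0] := eqVneq (f x) 0; first by rewrite normr0 mulr_ge0.
  (* rotating [x] makes [f x] real, where the real bound applies *)
  pose u := (f x)^* / `|f x|.
  have nu : `|u| = 1 by rewrite normrM normfV normr_id normcJ mulfV// normr_eq0.
  have fu : f (u *: x) = `|f x|.
    have := flin u x 0; rewrite addr0 => ->.
    have -> : f 0 = 0 by rewrite /f scaler0 F0 oppr0.
    rewrite addr0 /GRing.scale/= /u mulrAC [_^* * _]mulrC -sqr_normc.
    by rewrite expr2 mulfK// normr_eq0.
  have := Fp (u *: x); rewrite -lecR pE normrZ nu mul1r.
  have -> : F (u *: x) = complex.Re (f (u *: x)) by [].
  by rewrite fu RRe_real// ger0_real.
have [g gf gM] := dual_of_bounded flin M0 fM.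
exists g => // -[x a] Gxa; rewrite gf /f /=.
have -> : F x = complex.Re a by have := FG (x, complex.Re a); apply; exists (x, a).
have -> : F ('i%C *: x) = complex.Re ('i%C * a).
  have := FG ('i%C *: x, complex.Re ('i%C * a)); apply.
  exists ('i%C *: x, 'i%C * a) => //.
  by have := Glin 'i%C _ _ Gxa G0; rewrite /= !addr0.
by case: a {Gxa} => a b; apply/eqP; rewrite eq_complex /= mul0r mul1r sub0r opprK !eqxx.
Qed.

End ComplexHahnBanach.

(** * Norming, extending and separating functionals *)

Section DualConsequences.
Context {R : realType} {V : normedModType R[i]}.
Implicit Types (f g : dual V) (S Y : submodClosed V) (x y w : V).

Lemma submod_closed0 : submod_closed (pred1 (0 : V)).
Proof.
by split=> [|a x y]; rewrite !inE// => /eqP -> /eqP ->; rewrite scaler0 addr0.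
Qed.

HB.instance Definition _ :=
  GRing.isSubmodClosed.Build R[i] V (pred1 (0 : V)) submod_closed0.

Definition zero_subsp : submodClosed V := pred1 (0 : V).

(** On the span of [w] and [Y], the assignment of l d to l w + y has bound 1, because [d] is at most
    the distance from [w] to [Y]. *)
Lemma dist_functional Y w (d : R[i]) : 0 <= d ->
  (forall y, y \in Y -> d <= `|w + y|) ->
  exists f : dual V, [/\ Ann Y f, `|f| <= 1 & f w = d].
Proof.
move=> d0 dY.
pose G := [set u : V * R[i] | exists l, exists2 y, y \in Y & u = (l *: w + y, l * d)].
have [||||f f1 fG] := @hahn_banach_graph _ _ G 1.
- by [].
- by exists 0, 0; rewrite ?rpred0// scale0r mul0r addr0.
- move=> l _ _ [a [y Yy ->]] [b [z Yz ->]] /=.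
  exists (l * a + b), (l *: y + z); first by rewrite rpredD// rpredZ.
  congr pair; last by ring.
  by rewrite scalerDr scalerDl scalerA addrACA.
- move=> _ [l [y Yy ->]] /=; rewrite mul1r.
  have [->|l0] := eqVneq l 0; first by rewrite mul0r normr0.
  have -> : l *: w + y = l *: (w + l^-1 *: y) by rewrite scalerDr scalerA mulfV// scale1r.
  by rewrite normrM normrZ (ger0_norm d0) ler_wpM2l// dY// rpredZ.
exists f; split => //.
- move=> y Yy; have := fG (y, 0); apply.
  by exists 0, y; rewrite // scale0r mul0r add0r.
- have := fG (w, d); apply; exists 1, 0; first exact: rpred0.
  by rewrite scale1r mul1r addr0.
Qed.

(** Orthogonality says that the distance from [w] to [Y] is |w|. *)
Lemma birkhoff_james_functional Y w :
  (forall y, y \in Y -> birkhoff_james w y) ->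
  exists f : dual V, [/\ Ann Y f, `|f| <= 1 & f w = `|w|].
Proof.
move=> wY; apply: dist_functional => // y Yy.
by have := wY y Yy 1; rewrite scale1r.
Qed.

Lemma norming_functional w : exists2 f : dual V, `|f| <= 1 & f w = `|w|.
Proof.
have [||f [_ f1 fw]] := @dist_functional zero_subsp w `|w|; last by exists f.
- by [].
- by move=> y /eqP ->; rewrite addr0.
Qed.

Lemma norm1_norming f w : `|f| <= 1 -> f w = `|w| -> w != 0 -> `|f| = 1.
Proof.
move=> f1 fw w0; apply/eqP; rewrite eq_le f1/=.
have := dual_le f w; rewrite fw normr_id -[leLHS]mul1r ler_pM2r//.
by rewrite normr_gt0.
Qed.

Lemma norm_extension S (g : dual (subsp S)) :
  exists2 f : dual V, restr S f = g & `|f| = `|g|.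
Proof.
pose G := [set (val x, g x : R[i]) | x in [set: subsp S]].
have [||||f fg fG] := @hahn_banach_graph _ V G `|g|.
- exact: normr_ge0.
- by exists 0 => //; congr pair; exact: linear0.
- move=> l _ _ [x _ <-] [y _ <-] /=; exists (l *: x + y) => //.
  by congr pair; exact: linearP.
- by move=> _ [x _ <-] /=; exact: dual_le.
have rf : restr S f = g.
  by apply/val_inj/funext => x /=; have := fG (val x, g x); apply; exists x.
exists f => //; apply/eqP; rewrite eq_le fg/= -rf.
by apply: dual_norm_le => // x; exact: dual_le.
Qed.

Lemma restr_norm_le S f : `|restr S f| <= `|f|.
Proof. by apply: dual_norm_le => // x; exact: dual_le. Qed.

(** A ball around [x] missing [Y] has as radius a positive lower bound for the distance. *)
Lemma separation Y x : closed [set` Y] -> x \notin Y ->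
  exists2 f : dual V, Ann Y f & f x != 0.
Proof.
move=> Ycl xY.
have : nbhs x (~` [set` Y]).
  by apply: open_nbhs_nbhs; split; [exact: closed_openC|exact/negP].
move=> /nbhs_ballP[d /= d0 dY].
have [||f [fY _ fx]] := @dist_functional Y x d; first exact: ltW.
  move=> y Yy; rewrite real_leNgt ?normr_real ?gtr0_real//.
  apply/negP => xyd; have := dY (- y).
  rewrite -ball_normE /= opprK => /(_ xyd); apply.
  by rewrite -scaleN1r rpredZ.
by exists f; rewrite ?fx ?gt_eqF.
Qed.

End DualConsequences.

(** * Consequences of reflexivity *)

Section Reflexivity.
Context {R : realType}.

Lemma ev_exists (V : normedModType R[i]) (x : V) :
  exists phi : dual (dual V), forall f, phi f = f x.
Proof.
have [|||phi phix _] := @dual_of_bounded _ (dual V) (fun f => f x) `|x|.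
- by move=> l f g.
- exact: normr_ge0.
- by move=> f; rewrite mulrC; exact: dual_le.
by exists phi.
Qed.

Lemma bidual_norm_ev (V : normedModType R[i]) (x : V) (phi : dual (dual V)) :
  (forall f, phi f = f x) -> `|phi| = `|x|.
Proof.
move=> phix; apply/eqP; rewrite eq_le; apply/andP; split.
  by apply: dual_norm_le => // f; rewrite phix mulrC; exact: dual_le.
have [f f1 fx] := norming_functional x.
rewrite -[`|x|]normr_id -fx -phix (le_trans (dual_le phi f))//.
by rewrite ler_piMr.
Qed.

(** A functional on the dual that norms [f] is evaluation at a point, and that point has norm
    one. *)
Lemma reflexive_attains (V : normedModType R[i]) (f : dual V) :
  reflexive_space V -> f != 0 -> exists2 x, `|x| = 1 & f x = `|f|.
Proof.
move=> Vrefl f0; have [phi phi1 phif] := norming_functional f.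
have [x phix] := Vrefl phi; exists x; last by rewrite -phix.
by rewrite -(bidual_norm_ev phix); exact: norm1_norming phi1 phif f0.
Qed.

(** Composing [psi] with restriction gives an element of the bidual of [V], represented by some [x].
    Since [psi] only sees restrictions to [S], separation forces [x] into [S]. *)
Lemma reflexive_subsp (V : normedModType R[i]) (S : submodClosed V) :
  closed [set` S] -> reflexive_space V -> reflexive_space (subsp S).
Proof.
move=> Scl Vrefl psi.
have [|||phi phiE _] := @dual_of_bounded _ (dual V) (fun f => psi (restr S f)) `|psi|.
- by move=> l f g; rewrite linearP [psi _]linearP.
- exact: normr_ge0.
- by move=> f; rewrite (le_trans (dual_le _ _))// ler_wpM2l// restr_norm_le.
have [x phix] := Vrefl phi.
have xS : x \in S.
  apply: contrapT => /negP /(separation Scl)[f fS /eqP]; apply.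
  rewrite -phix phiE (_ : restr S f = 0) ?linear0//.
  by apply/val_inj/funext => y /=; apply: fS; exact: (valP y).
exists (exist _ x xS) => g; have [f <- _] := norm_extension g.
by rewrite -phiE phix.
Qed.

End Reflexivity.

(** * Vectors orthogonal to [Y] and norm attainment *)

Section Orthogonality.
Context {R : realType} {V : normedModType R[i]}.
Implicit Types (f g : dual V) (Y Z : submodClosed V) (x y z : V).

Definition orth Y : set V := [set x | forall y, y \in Y -> birkhoff_james x y].

Lemma orth_le Y x y : orth Y x -> y \in Y -> `|x| <= `|x + y|.
Proof. by move=> xY /xY/(_ 1); rewrite scale1r. Qed.

Lemma orthP Y x : (forall y, y \in Y -> `|x| <= `|x + y|) -> orth Y x.
Proof. by move=> xY y Yy l; apply: xY; rewrite rpredZ. Qed.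

Lemma orth0 Y : orth Y 0.
Proof. by move=> y _ l; rewrite normr0. Qed.

Lemma orthZ Y x (l : R[i]) : orth Y x -> orth Y (l *: x).
Proof.
have [->|l0] := eqVneq l 0; first by move=> _; rewrite scale0r; exact: orth0.
move=> xY; apply: orthP => y Yy.
have -> : l *: x + y = l *: (x + l^-1 *: y) by rewrite scalerDr scalerA mulfV// scale1r.
by rewrite !normrZ ler_wpM2l// (orth_le xY)// rpredZ.
Qed.

(** If [z] in [orth Y] is within e/2 of [x], then |x| <= |x - z| + |z| <= 2|x - z| + |x + y| <= |x +
    y| + e. *)
Lemma orth_closed Y : closed (orth Y).
Proof.
move=> x xcl; apply: orthP => y Yy; apply/ler_addgt0Pr => e e0.
have e20 : 0 < e / 2 by rewrite divr_gt0.
have [z [zY]] := xcl _ (nbhsx_ballx x (e / 2) e20).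
rewrite -ball_normE /= => xz.
have zy : `|z| <= `|x + y| + `|x - z|.
  apply: le_trans (orth_le zY Yy) _.
  have -> : z + y = (x + y) - (x - z) by rewrite opprB [RHS]addrC addrA subrK.
  exact: ler_normB.
apply: (@le_trans _ _ (`|x - z| + `|z|)).
  by rewrite -[in leLHS](subrK z x) ler_normD.
apply: le_trans (lerD (lexx _) zy) _.
by rewrite addrCA lerD2l [leRHS]splitr lerD// ltW.
Qed.

(** For [y] in [Y], |f| |x| = |f x| = |f (x + y)| <= |f| |x + y|. *)
Lemma Ann_orth Y f x : Ann Y f -> f != 0 -> `|f x| = `|f| * `|x| -> orth Y x.
Proof.
move=> fY f0 fx; apply: orthP => y Yy.
rewrite -(@ler_pM2l _ `|f|) ?normr_gt0// -fx.
by rewrite -[f x]addr0 -(fY y Yy) -linearD; exact: dual_le.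
Qed.

Lemma sphere_orth Y :
  sphere (orth Y) = \bigcup_(f in Ann Y `\` [set 0]) norm_attainment (f : dual V).
Proof.
apply/seteqP; split=> x.
- move=> [xY x1]; have [f [fY f1 fx]] := birkhoff_james_functional xY.
  have x0 : x != 0 by rewrite -normr_gt0 x1.
  have nf := norm1_norming f1 fx x0.
  exists f.
    by split=> //= f0; move: nf; rewrite f0 normr0 => /esym/eqP; rewrite oner_eq0.
  by split=> //; rewrite fx normr_id x1 -nf.
- move=> [f [fY /eqP f0] [x1 fx]]; split=> //.
  by apply: (Ann_orth fY f0); rewrite x1 mulr1.
Qed.

(** Both sets contain 0 and are stable under scalars, so unit vectors determine them. *)
Lemma sphere_orth_eq Y Z : sphere [set` Z] = sphere (orth Y) -> [set` Z] = orth Y.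
Proof.
have unit x : x != 0 -> `| `|x|^-1 *: x| = 1.
  by move=> x0; rewrite normrZ normfV normr_id mulVf// normr_eq0.
have xE x : x != 0 -> x = `|x| *: (`|x|^-1 *: x).
  by move=> x0; rewrite scalerA mulfV ?scale1r// normr_eq0.
move=> ZY; apply/seteqP; split=> x /=.
- have [->|x0] := eqVneq x 0; first by move=> _; exact: orth0.
  move=> xZ; rewrite (xE x x0); apply: orthZ.
  suff [] : sphere (orth Y) (`|x|^-1 *: x) by [].
  by rewrite -ZY; split; [rewrite /= rpredZ|exact: unit].
- have [->|x0] := eqVneq x 0; first by move=> _; exact: rpred0.
  move=> xY; rewrite (xE x x0) rpredZ//.
  suff [] : sphere [set` Z] (`|x|^-1 *: x) by [].
  by rewrite ZY; split; [exact: orthZ|exact: unit].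
Qed.

Lemma subsp_orth0 Y x : x \in Y -> orth Y x -> x = 0.
Proof.
move=> xY xo; have := orth_le xo (rpredZ (-1) xY).
by rewrite scaleN1r subrr normr0 normr_le0 => /eqP.
Qed.

Lemma Ann_neq0 Y : closed [set` Y] -> [set` Y] <> setT ->
  exists2 f : dual V, Ann Y f & f != 0.
Proof.
move=> Ycl YT; have [x xY] : exists x, x \notin Y.
  apply: contrapT => nY; apply: YT; apply/seteqP; split=> // x _ /=.
  by apply: contrapT => /negP xY; apply: nY; exists x.
have [f fY fx] := separation Ycl xY; exists f => //.
by apply: contra_neq fx => ->.
Qed.

(** Recasts [Ann Y] as a [submodClosed], so that [restr] and [norm_extension] apply to it. *)
Definition Ann_pred Y : {pred dual V} := fun f => `[< Ann Y f >].

Lemma Ann_submod Y : submod_closed (Ann_pred Y).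
Proof.
split=> [|a f g /asboolP fY /asboolP gY]; apply/asboolP => y Yy //.
have -> : (a *: f + g) y = a *: f y + g y by [].
by rewrite fY// gY// scaler0 addr0.
Qed.

HB.instance Definition _ Y := GRing.isSubmodClosed.Build R[i] (dual V)
  (Ann_pred Y) (Ann_submod Y).

Definition Ann_subsp Y : submodClosed (dual V) := Ann_pred Y.

(* Among the representatives of evaluation at [x] on [Ann Y], reflexivity
   provides one of minimal norm, and this one is orthogonal to [Y]. *)
Lemma orth_decomposition Y : closed [set` Y] -> reflexive_space V ->
  forall x, exists2 y, y \in Y & exists2 w, orth Y w & x = y + w.
Proof.
move=> Ycl Vrefl x; have [ev evx] := ev_exists x.
have [phi phir phin] := norm_extension (restr (Ann_subsp Y) ev).
have [w phiw] := Vrefl phi.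
have wx f : Ann Y f -> f w = f x.
  move=> fY; have fA : f \in Ann_subsp Y by apply/asboolP.
  have := congr1 (fun h : dual (subsp (Ann_subsp Y)) => h (exist _ f fA)) phir.
  by rewrite /= phiw evx.
(* All of [Ann Y] vanishes at x - w, which separation therefore places in [Y]. *)
exists (x - w).
  apply: contrapT => /negP /(separation Ycl)[f fY /eqP]; apply.
  by rewrite linearB/= wx// subrr.
exists w; last by rewrite subrK.
apply: orthP => y Yy; rewrite -(bidual_norm_ev phiw) phin.
apply: dual_norm_le => // -[g gA]; have /asboolP gY := gA.
(* On [Ann Y], evaluation at [x] and at w + y coincide, so its norm there, which is |w|, is at most
   |w + y|. *)
have -> : restr (Ann_subsp Y) ev (exist _ g gA) = g (w + y).
  have gwy : g (w + y) = g x by rewrite linearD /= (gY y Yy) (wx _ gY) addr0.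
  by rewrite gwy -evx.
rewrite mulrC.
exact: (dual_le g (w + y)).
Qed.

(** Were [x] and [z] distinct, their midpoint would have norm below 1 while [f] still takes there a
    value of modulus |f|. *)
Lemma norm_attaining_unique f x z : strictly_convex V -> f != 0 ->
  `|x| = 1 -> `|z| = 1 -> `|f x| = `|f| -> f x = f z -> x = z.
Proof.
move=> Vsc f0 x1 z1 fx fxz; apply: contrapT => xz.
have h : ((2^-1 : R)%:C + (1 - 2^-1)%:C : R[i]) = 1.
  by rewrite -rmorphD/= addrC subrK.
have half_gt0 : 0 < 2^-1 :> R by rewrite invr_gt0.
have half_lt1 : 2^-1 < 1 :> R by rewrite invf_lt1 ?ltr1n.
have := Vsc x z 2^-1 x1 z1 xz half_gt0 half_lt1.
apply/negP; rewrite -real_leNgt ?normr_real ?real1//.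
rewrite -(@ler_pM2l _ `|f|) ?normr_gt0// mulr1 -{1}fx.
have <- : f ((2^-1 : R)%:C *: x + (1 - 2^-1)%:C *: z) = f x.
  by rewrite linearP linearZ/= -fxz -scalerDl h scale1r.
exact: dual_le.
Qed.

(** After rotating [x] so that the common value becomes 1, both are support functionals of the same
    unit vector. *)
Lemma support_functional_unique f g x : smooth V ->
  `|f| = 1 -> `|g| = 1 -> `|x| = 1 -> `|f x| = 1 -> f x = g x -> f = g.
Proof.
move=> Vsm f1 g1 x1 fx1 fg; pose u := (f x)^-1 *: x.
have fx0 : f x != 0 by rewrite -normr_gt0 fx1.
have u1 : `|u| = 1 by rewrite normrZ normfV fx1 invr1 x1 mulr1.
have u0 : u != 0 by rewrite -normr_gt0 u1.
have uE (k : dual V) : k x = f x -> k u = `|u| ^+ 2.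
  by move=> kf; rewrite linearZ /= kf u1 expr1n; exact: mulVf.
have [h [_ hu]] := Vsm u u0.
transitivity h; last by apply: hu; split; [rewrite g1|apply: uE].
by apply/esym/hu; split; [rewrite f1|apply: uE].
Qed.

End Orthogonality.

(** * The four implications between the conditions *)

Section Implications.
Context {R : realType} {V : normedModType R[i]}.
Implicit Types (f g : dual V) (Y Z : submodClosed V) (x y z : V).

(** (i) implies (ii). For a unit [x] in [orth Y], choose [f] in [Ann Y] attaining its norm at [x].
    The component of [x] in [Z] has the same value under [f], and also norm one, so it is [x] by
    strict convexity. *)
Lemma left_complemented_sphere Y : strictly_convex V -> [set` Y] <> setT ->
  left_complemented Y -> exists Z, [set` Z] <> [set 0] /\
    sphere [set` Z] = \bigcup_(f in Ann Y `\` [set 0]) norm_attainment (f : dual V).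
Proof.
move=> Vsc YT [Z [_ _ dec ZY]]; exists Z; split.
  move=> Z0; apply: YT; apply/seteqP; split=> // x _ /=.
  have [y Yy [z Zz ->]] := dec x.
  suff -> : z = 0 by rewrite addr0.
  by have : [set` Z] z by []; rewrite Z0.
rewrite -sphere_orth; apply/seteqP; split=> x [xZ x1]; split=> //.
  by move=> y Yy; exact: ZY.
have : sphere (orth Y) x by [].
rewrite sphere_orth => -[f [fY /eqP f0] [_ fx]].
have [y Yy [z Zz xyz]] := dec x.
have fz : f x = f z by rewrite xyz linearD /= (fY y Yy) add0r.
have xz : `|z| = 1.
  apply/eqP; rewrite eq_le; apply/andP; split.
    by rewrite -x1 xyz addrC; have := ZY z y Zz Yy 1; rewrite scale1r.
  rewrite -(@ler_pM2l _ `|f|) ?normr_gt0// mulr1 -[leLHS]fx fz.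
  exact: dual_le.
by rewrite /= (norm_attaining_unique Vsc f0 x1 xz fx fz).
Qed.

(** By reflexivity [f] attains its norm, and it does so at a point of [orth Y], that is, of [Z]. *)
Lemma restr_Ann_isometry Y Z : reflexive_space V -> [set` Z] = orth Y ->
  forall f, Ann Y f -> `|restr Z f| = `|f|.
Proof.
move=> Vrefl ZY f fY; apply/eqP; rewrite eq_le restr_norm_le/=.
have [->|f0] := eqVneq f 0; first by rewrite normr0.
have [x x1 fx] := reflexive_attains Vrefl f0.
have xZ : [set` Z] x.
  by rewrite ZY; apply: (Ann_orth fY f0); rewrite fx normr_id x1 mulr1.
have := dual_le (restr Z f) (exist _ x xZ).
have -> : `|exist _ x xZ : subsp Z| = 1 by exact: x1.
by rewrite mulr1 [X in `|X|](_ : _ = f x)// fx normr_id.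
Qed.

(* Functionals on [Z] are pulled back along the projection onto [Z] parallel
   to [Y], which is contractive since [Z] is orthogonal to [Y]. *)
Lemma restr_Ann_surj Y Z : closed [set` Y] -> reflexive_space V ->
  [set` Z] = orth Y -> set_surj (Ann Y) setT (restr Z).
Proof.
move=> Ycl Vrefl ZY g _.
have ZYP x : x \in Z -> orth Y x by move=> xZ; have : [set` Z] x by []; rewrite ZY.
have dec x : exists p : subsp Z, x - val p \in Y.
  have [y Yy [w wY ->]] := orth_decomposition Ycl Vrefl x.
  have wZ : [set` Z] w by rewrite ZY.
  by exists (exist _ w wZ); rewrite /= addrK.
have [P PY] := choice dec.
(* Two candidates differ by an element of [Z], which is orthogonal to [Y] and also lies in [Y].
   Linearity of [P] follows from this uniqueness. *)
have Puniq x (p : subsp Z) : x - val p \in Y -> P x = p.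
  move=> xp; apply/eqP; rewrite -subr_eq0; apply/eqP/val_inj.
  apply: (@subsp_orth0 _ _ Y); last exact/ZYP/(valP (P x - p)).
  have -> : val (P x - p) = (x - val p) + (-1) *: (x - val (P x)).
    by rewrite scaleN1r opprB [RHS]addrC addrA subrK.
  by apply: rpredD => //; apply: rpredZ; exact: PY.
have Plin : linear P.
  move=> l x y; apply: Puniq.
  have -> : l *: x + y - val (l *: P x + P y) = l *: (x - val (P x)) + (y - val (P y)).
    by rewrite scalerBr /= opprD addrACA.
  by apply: rpredD; [apply: rpredZ|]; exact: PY.
have Ple x : `|val (P x)| <= `|x|.
  have -> : `|x| = `|val (P x) + (x - val (P x))| by rewrite addrC subrK.
  exact: orth_le (ZYP _ (valP (P x))) (PY x).
have [|||f fE _] := @dual_of_bounded _ V (fun x => g (P x)) `|g|.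
- by move=> l x y; rewrite Plin; exact: linearP.
- exact: normr_ge0.
- move=> x; apply: le_trans (dual_le g (P x)) _.
  by apply: ler_wpM2l; [exact: normr_ge0|exact: Ple].
exists f.
  move=> y Yy; rewrite fE (Puniq y 0); first exact: linear0.
  by rewrite /= subr0.
apply/val_inj/funext => p /=; rewrite fE; congr (g _); apply: Puniq.
by rewrite subrr rpred0.
Qed.

Lemma sphere_restr_Ann Y Z : closed [set` Y] -> reflexive_space V ->
  sphere [set` Z] = \bigcup_(f in Ann Y `\` [set 0]) norm_attainment (f : dual V) ->
  [/\ closed [set` Z], (forall f, Ann Y f -> `|restr Z f| = `|f|) &
      set_surj (Ann Y) setT (restr Z)].
Proof.
move=> Ycl Vrefl; rewrite -sphere_orth => /sphere_orth_eq ZY; split.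
- by rewrite ZY; exact: orth_closed.
- exact: restr_Ann_isometry.
- exact: restr_Ann_surj.
Qed.

Lemma restr_opnorm_le1 Z : opnorm (restr Z) <= 1.
Proof.
by apply: opnorm_le => // f; rewrite mul1r; exact: restr_norm_le.
Qed.

Lemma restr_opnorm1 Z f : f != 0 -> `|restr Z f| = `|f| -> opnorm (restr Z) = 1.
Proof.
move=> f0 fZ; apply/eqP; rewrite eq_le restr_opnorm_le1/=.
have rc : continuous (restr Z).
  apply: bounded_linear_continuous; apply/linear_boundedP.
  near=> r; move=> g; apply: le_trans (restr_norm_le Z g) _.
  by rewrite ler_peMl//; near: r; apply: nbhs_pinfty_ge; exact: real1.
have := le_opnorm rc f.
by rewrite fZ -[leLHS]mul1r ler_pM2r// normr_gt0.
Unshelve. all: by end_near. Qed.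

(** (iii) implies (iv). Since [subsp Z] is reflexive, restrictions of [Ann Y] attain their norms in
    [Z]. *)
Lemma restr_Ann_attainment Y Z :
  reflexive_space V -> smooth V -> closed [set` Y] -> [set` Y] <> setT ->
  closed [set` Z] -> (forall f, Ann Y f -> `|restr Z f| = `|f|) ->
  set_surj (Ann Y) setT (restr Z) ->
  [/\ (forall f, Ann Y f -> attains_norm_in f Z), opnorm (restr Z) = 1 &
      norm_attainment (restr Z) = sphere (Ann Y)].
Proof.
move=> Vrefl Vsm Ycl YT Zcl iso surj.
have Zrefl := reflexive_subsp Zcl Vrefl.
have [f1 f1Y f10] := Ann_neq0 Ycl YT.
have att f : Ann Y f -> f != 0 -> exists2 z : subsp Z, `|z| = 1 & f (val z) = `|f|.
  move=> fY f0; have rf0 : restr Z f != 0 by rewrite -normr_gt0 iso// normr_gt0.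
  have [z z1 fz] := reflexive_attains Zrefl rf0; exists z => //.
  by rewrite -(iso f fY) -fz.
have op1 : opnorm (restr Z) = 1 by exact: restr_opnorm1 f10 (iso _ f1Y).
split=> //.
- move=> f fY; have [->|f0] := eqVneq f 0.
    (* The zero functional still needs a unit vector in [Z]; a nonzero element of [Ann Y] supplies
       it. *)
    have [z z1 _] := att f1 f1Y f10; exists (val z); split; last by rewrite !normr0.
    by split; [exact: (valP z)|].
  have [z z1 fz] := att f fY f0; exists (val z); split; last by rewrite fz normr_id.
  by split; [exact: (valP z)|].
- apply/seteqP; split=> f.
    rewrite /norm_attainment /= op1 => -[nf rf]; split=> //.
    (* [g] in [Ann Y] has the same restriction as [f] and attains its norm at a point of [Z], where
       both agree; smoothness gives f = g. *)
    have [g gY gf] := surj (restr Z f) I.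
    have ng : `|g| = 1 by rewrite -(iso g gY) gf.
    have g0 : g != 0 by rewrite -normr_gt0 ng.
    have [z z1 gz] := att g gY g0.
    have fgz : f (val z) = g (val z).
      by have := congr1 (fun h : dual (subsp Z) => h z) gf.
    have z1' : `|val z| = 1 by exact: z1.
    rewrite (@support_functional_unique _ _ f g (val z))//.
    by rewrite fgz gz normr_id.
  by move=> [fY nf]; split=> //; rewrite op1 iso.
Qed.

(** (iv) implies (i). Once [Z] is identified with [orth Y], it is closed, meets [Y] only in 0 and
    complements it by [orth_decomposition]. *)
Lemma attainment_left_complemented Y Z :
  reflexive_space V -> strictly_convex V -> closed [set` Y] -> [set` Y] <> setT ->
  (forall f, Ann Y f -> attains_norm_in f Z) -> opnorm (restr Z) = 1 ->
  norm_attainment (restr Z) = sphere (Ann Y) -> left_complemented Y.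
Proof.
move=> Vrefl Vsc Ycl YT att op1 attE.
have ZY : [set` Z] = orth Y.
  apply: sphere_orth_eq; apply/seteqP; split=> x [xZ x1].
    split=> //; have x0 : x != 0 by rewrite -normr_gt0 x1.
    (* A functional norming a unit vector of [Z] keeps its norm on [Z], so [attE] places it in
       [Ann Y]. *)
    have [f f1 fx] := norming_functional x.
    have nf := norm1_norming f1 fx x0.
    have : norm_attainment (restr Z) f.
      split=> //; apply/eqP; rewrite op1 eq_le -{1}nf restr_norm_le/=.
      have := dual_le (restr Z f) (exist _ x xZ).
      have -> : `|exist _ x xZ : subsp Z| = 1 by exact: x1.
      by rewrite mulr1 [X in `|X|](_ : _ = f x)// fx normr_id x1.
    rewrite attE => -[fY _]; apply: (Ann_orth fY); first by rewrite -normr_gt0 nf.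
    by rewrite fx normr_id nf mul1r.
  have : sphere (orth Y) x by [].
  rewrite sphere_orth => -[f [fY /eqP f0] [_ fx]]; split=> //.
  have {}fx : `|f x| = `|f| by exact: fx.
  have [z [[zZ z1] fz]] := att f fY.
  have fz0 : f z != 0 by rewrite -normr_gt0 fz normr_gt0.
  (* The phase for which [f] takes the same value at c z and at [x]. *)
  pose c : R[i] := f x / f z.
  have c1 : `|c| = 1 by rewrite normrM normfV fx -fz divff ?normr_eq0.
  have -> : x = c *: z.
    apply: (norm_attaining_unique Vsc f0 x1); first by rewrite normrZ c1 z1 mulr1.
      by rewrite fx.
    by rewrite linearZ /=; apply/esym; exact: divfK.
  by rewrite /= rpredZ.
have ZYP x : x \in Z -> orth Y x by move=> xZ; have : [set` Z] x by []; rewrite ZY.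
exists Z; split.
- by rewrite ZY; exact: orth_closed.
- apply/seteqP; split=> x; first by move=> [Yx /ZYP]; exact: subsp_orth0.
  by move=> ->; split; exact: rpred0.
- move=> x; have [y Yy [w wY ->]] := orth_decomposition Ycl Vrefl x.
  exists y => //; exists w => //.
  by have : [set` Z] w by rewrite ZY.
- by move=> z y /ZYP zY /zY.
Qed.

End Implications.

Theorem theorem4p5 (R : realType) (X : completeNormedModType R[i])
    (Y : submodClosed X)
    (X_reflexive : reflexive_space X)
    (X_smooth : smooth X)
    (X_strictly_convex : strictly_convex X)
    (Y_closed : closed [set` Y])
    (Y_proper : [set` Y] <> setT) :
  [<->
    left_complemented Y;
    exists Yt : submodClosed X,
      [set` Yt] <> [set 0] /\
      sphere [set` Yt] =
        \bigcup_(f in Ann Y `\` [set 0]) norm_attainment (f : dual X);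
    exists Y1 : submodClosed X,
      [/\ closed [set` Y1],
          (forall f, Ann Y f -> `|restr Y1 f| = `|f|) &
          set_surj (Ann Y) setT (restr Y1)];
    exists Y1 : submodClosed X,
      [/\ (forall f, Ann Y f -> attains_norm_in f Y1),
          opnorm (restr Y1) = 1 &
          norm_attainment (restr Y1) = sphere (Ann Y)]
  ].
Proof.
split; first exact: left_complemented_sphere.
split.
  by move=> [Z [_ ZE]]; exists Z; exact: sphere_restr_Ann.
split.
  by move=> [Z [Zcl iso surj]]; exists Z; exact: restr_Ann_attainment.
by move=> [Z [att op1 attE]]; exact: attainment_left_complemented attE.
Qed.
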